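(* Suppose that $M\subseteq N$ are models of $\mathsf{IZF}$ such that $M$ satisfies the following weak instance of excluded middle: for any set $\{a_n:n\in\omega\}$ of distinct ordinals and any $x$, if $x\in\bigcup_n a_n$ and for some $k$, $x\notin\bigcup_{n\neq k}a_n$, then $x\in a_k$. Suppose further that in $M$ there is an ordinal $\alpha$ such that $\alpha\notin\omega$ and $\omega\not\subseteq\alpha$. Then \[ \mathrm{Ord}\cap N=\mathrm{Ord}\cap M\ \Longrightarrow\ ({}^{\omega}2)^{N}=({}^{\omega}2)^{M}. \]
   Context: $\mathsf{IZF}$ is the theory with intuitionistic logic whose axioms are Extensionality, Empty Set, Pairing, Unions, Power Set, Strong Infinity, Set Induction scheme, full Separation scheme and full Collection scheme. An ordinal is a transitive set of transitive sets. ${}^{\omega}2$ is the set of functions from $\omega$ to $2=\{0,1\}$, and $(\cdot)^M$, $(\cdot)^N$ denote its computation in $M$, $N$ respectively.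
   Formalization: M is assumed transitive in N (every element in N of a member of M lies in M), a convention left implicit in ''M ⊆ N are models''; without it the claim fails for suitable non-transitive isomorphic copies of N inside N with the same ordinals. *)

(* Defs.v *)
From Stdlib Require Fin.

(** Over a classical metatheory a two-valued structure obeys excluded middle,
    so an ordinal [α] with [α ∉ ω] and [ω ⊄ α] could not exist in it.  Models of
    IZF are therefore structures in which the truth value of a formula lies in
    an arbitrary complete Heyting algebra, and a sentence holds when its truth
    value is [⊤].  This semantics is sound and complete for intuitionistic
    first-order logic; [Prop] and the algebra of up-sets of a Kripke frame are
    instances. *)

Record completeHeyting : Type := CompleteHeyting {
  tv :> Type;
  le : tv -> tv -> Prop;
  top : tv;
  bot : tv;
  meet : tv -> tv -> tv;
  join : tv -> tv -> tv;
  imp : tv -> tv -> tv;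
  inf : forall I : Type, (I -> tv) -> tv;
  sup : forall I : Type, (I -> tv) -> tv;
  le_refl : forall p, le p p;
  le_trans : forall p q r, le p q -> le q r -> le p r;
  le_antisym : forall p q, le p q -> le q p -> p = q;
  le_top : forall p, le p top;
  le_bot : forall p, le bot p;
  le_meet : forall p q r, le r (meet p q) <-> (le r p /\ le r q);
  join_le : forall p q r, le (join p q) r <-> (le p r /\ le q r);
  le_imp : forall p q r, le r (imp p q) <-> le (meet r p) q;
  le_inf : forall (I : Type) (F : I -> tv) r,
    le r (inf I F) <-> (forall i, le r (F i));
  sup_le : forall (I : Type) (F : I -> tv) r,
    le (sup I F) r <-> (forall i, le (F i) r)
}.

Arguments le {_} _ _.
Arguments top {_}.
Arguments bot {_}.
Arguments meet {_} _ _.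
Arguments join {_} _ _.
Arguments imp {_} _ _.
Arguments inf {_ I} _.
Arguments sup {_ I} _.

Declare Scope heyting_scope.
Delimit Scope heyting_scope with H.
Open Scope heyting_scope.

Notation "⊤" := top : heyting_scope.
Notation "⊥" := bot : heyting_scope.
Notation "p ⊓ q" := (meet p q) (at level 80, right associativity) : heyting_scope.
Notation "p ⊔ q" := (join p q) (at level 85, right associativity) : heyting_scope.
Notation "p ⇒ q" := (imp p q)
  (at level 90, right associativity, q at level 200) : heyting_scope.
Notation "p ⇔ q" := (meet (imp p q) (imp q p))
  (at level 95, no associativity) : heyting_scope.
Notation "∼ p" := (imp p bot) (at level 75, right associativity) : heyting_scope.

Definition valid {H : completeHeyting} (p : H) : Prop := le top p.

Record structure (H : completeHeyting) : Type := Structure {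
  carrier :> Type;
  mem : carrier -> carrier -> H;
  eqv : carrier -> carrier -> H;
  eqv_refl : forall x, valid (eqv x x);
  eqv_sym : forall x y, valid (eqv x y ⇒ eqv y x);
  eqv_trans : forall x y z, valid (eqv x y ⇒ eqv y z ⇒ eqv x z);
  mem_eqv : forall x x' y y',
    valid (eqv x x' ⇒ eqv y y' ⇒ mem x y ⇒ mem x' y')
}.

Arguments mem {_ _} _ _.
Arguments eqv {_ _} _ _.

Notation "x ∈ y" := (mem x y) (at level 70, no associativity) : heyting_scope.
Notation "x ≐ y" := (eqv x y) (at level 70, no associativity) : heyting_scope.
Notation "x ∉ y" := (imp (mem x y) bot)
  (at level 70, no associativity) : heyting_scope.

(** A class is again truth-valued: membership of [x] in [C] has a truth value. *)
Record cls {H : completeHeyting} (V : structure H) : Type := Cls {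
  inC :> V -> H;
  inC_eqv : forall x y, valid (x ≐ y ⇒ inC x ⇒ inC y)
}.

Arguments inC {_ _} _ _.

Definition all {H : completeHeyting} {V : structure H} (C : cls V)
  (P : V -> H) : H := inf (fun x => C x ⇒ P x).
Definition ex {H : completeHeyting} {V : structure H} (C : cls V)
  (P : V -> H) : H := sup (fun x => C x ⊓ P x).

Notation "∀[ C ] x .. y , P" := (all C (fun x => .. (all C (fun y => P)) ..))
  (at level 200, x binder, y binder, right associativity) : heyting_scope.
Notation "∃[ C ] x .. y , P" := (ex C (fun x => .. (ex C (fun y => P)) ..))
  (at level 200, x binder, y binder, right associativity) : heyting_scope.

(** Formulas of the language of set theory with free variables among
    [0, ..., n-1]; under a quantifier, variable [0] is the bound one. *)
Inductive formula : nat -> Type :=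
| FMem n : Fin.t n -> Fin.t n -> formula n
| FEq n : Fin.t n -> Fin.t n -> formula n
| FBot n : formula n
| FAnd n : formula n -> formula n -> formula n
| FOr n : formula n -> formula n -> formula n
| FImp n : formula n -> formula n -> formula n
| FAll n : formula (S n) -> formula n
| FEx n : formula (S n) -> formula n.

Definition ext {A : Type} {n : nat} (x : A) (e : Fin.t n -> A)
  (i : Fin.t (S n)) : A := Fin.caseS' i (fun _ => A) x e.

(** [sat C φ e] is the truth value of the relativisation of [φ] to [C]. *)
Fixpoint sat {H : completeHeyting} {V : structure H} (C : cls V) {n : nat}
  (φ : formula n) : (Fin.t n -> V) -> H :=
  match φ in formula m return (Fin.t m -> V) -> H with
  | FMem _ i j => fun e => e i ∈ e j
  | FEq _ i j => fun e => e i ≐ e j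
  | FBot _ => fun _ => ⊥
  | FAnd _ φ ψ => fun e => sat C φ e ⊓ sat C ψ e
  | FOr _ φ ψ => fun e => sat C φ e ⊔ sat C ψ e
  | FImp _ φ ψ => fun e => sat C φ e ⇒ sat C ψ e
  | FAll _ φ => fun e => ∀[C] x, sat C φ (ext x e)
  | FEx _ φ => fun e => ∃[C] x, sat C φ (ext x e)
  end.

Definition all_params {H : completeHeyting} {V : structure H} (C : cls V)
  {n : nat} (P : (Fin.t n -> V) -> H) : H :=
  inf (fun e : Fin.t n -> V => inf (fun i => C (e i)) ⇒ P e).

Section SetTheory.

Context {H : completeHeyting} {V : structure H} (C : cls V).

(** Every notion below is computed in [C], all quantifiers ranging over [C]. *)

Definition subset (a b : V) : H := ∀[C] x, x ∈ a ⇒ x ∈ b.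

Definition is_empty (a : V) : H := ∀[C] x, x ∉ a.

(** [s = x ∪ {x}] *)
Definition is_succ (x s : V) : H := ∀[C] z, z ∈ s ⇔ z ∈ x ⊔ z ≐ x.

Definition inductive (a : V) : H :=
  (∃[C] o, is_empty o ⊓ o ∈ a) ⊓
  (∀[C] x, x ∈ a ⇒ ∃[C] s, is_succ x s ⊓ s ∈ a).

Definition is_omega (w : V) : H :=
  inductive w ⊓ (∀[C] b, inductive b ⇒ subset w b).

Record IZF : Prop := {
  extensionality :
    valid (∀[C] a b, (∀[C] x, x ∈ a ⇔ x ∈ b) ⇒ a ≐ b);
  empty_set :
    valid (∃[C] a, is_empty a);
  pairing :
    valid (∀[C] a b, ∃[C] c, ∀[C] x, x ∈ c ⇔ x ≐ a ⊔ x ≐ b);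
  unions :
    valid (∀[C] a, ∃[C] u, ∀[C] x, x ∈ u ⇔ (∃[C] y, y ∈ a ⊓ x ∈ y));
  power_set :
    valid (∀[C] a, ∃[C] p, ∀[C] x, x ∈ p ⇔ subset x a);
  strong_infinity :
    valid (∃[C] w, is_omega w);
  set_induction : forall (n : nat) (φ : formula (S n)),
    valid (all_params C (fun e =>
      (∀[C] a, (∀[C] x, x ∈ a ⇒ sat C φ (ext x e)) ⇒ sat C φ (ext a e)) ⇒
      ∀[C] a, sat C φ (ext a e)));
  separation : forall (n : nat) (φ : formula (S n)),
    valid (all_params C (fun e =>
      ∀[C] a, ∃[C] b, ∀[C] x, x ∈ b ⇔ x ∈ a ⊓ sat C φ (ext x e)));
  collection : forall (n : nat) (φ : formula (S (S n))),
    valid (all_params C (fun e =>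
      ∀[C] a, (∀[C] x, x ∈ a ⇒ ∃[C] y, sat C φ (ext y (ext x e))) ⇒
      ∃[C] b, ∀[C] x, x ∈ a ⇒ ∃[C] y, y ∈ b ⊓ sat C φ (ext y (ext x e))))
}.

Definition transitive (a : V) : H := ∀[C] x, x ∈ a ⇒ subset x a.

Definition ordinal (a : V) : H :=
  transitive a ⊓ (∀[C] x, x ∈ a ⇒ transitive x).

(** [c = {a, b}] *)
Definition is_pair (a b c : V) : H := ∀[C] x, x ∈ c ⇔ x ≐ a ⊔ x ≐ b.

(** Kuratowski pairs: [p = {{a}, {a, b}}] *)
Definition is_opair (a b p : V) : H :=
  ∃[C] s t, is_pair a a s ⊓ is_pair a b t ⊓ is_pair s t p.

(** [(x, y) ∈ f] *)
Definition graph (f x y : V) : H := ∃[C] p, is_opair x y p ⊓ p ∈ f.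

(** [f] is a function with domain [d]. *)
Definition function_on (f d : V) : H :=
  (∀[C] p, p ∈ f ⇒ ∃[C] x y, x ∈ d ⊓ is_opair x y p) ⊓
  (∀[C] x, x ∈ d ⇒
     ∃[C] y, graph f x y ⊓ (∀[C] z, graph f x z ⇒ z ≐ y)).

Definition is_two (t : V) : H :=
  ∀[C] x, x ∈ t ⇔ is_empty x ⊔ (∃[C] o, is_empty o ⊓ is_succ o x).

(** [f : ω → 2] *)
Definition cantor (f : V) : H :=
  ∃[C] w t, is_omega w ⊓ is_two t ⊓ function_on f w ⊓
    (∀[C] x y, graph f x y ⇒ y ∈ t).

(** A family [(a_n)_{n ∈ ω}] is a function [a] with domain [w = ω]. *)
Definition distinct_ordinals (w a : V) : H :=
  function_on a w ⊓
  (∀[C] n y, graph a n y ⇒ ordinal y) ⊓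
  (∀[C] n m y z, graph a n y ⇒ graph a m z ⇒ ∼ (n ≐ m) ⇒ ∼ (y ≐ z)).

(** [x ∈ ⋃_n a_n] *)
Definition in_union (w a x : V) : H :=
  ∃[C] n y, n ∈ w ⊓ graph a n y ⊓ x ∈ y.

(** [x ∈ ⋃_{n ≠ k} a_n] *)
Definition in_union_except (w a k x : V) : H :=
  ∃[C] n y, n ∈ w ⊓ ∼ (n ≐ k) ⊓ graph a n y ⊓ x ∈ y.

Definition weak_excluded_middle : H :=
  ∀[C] w a, is_omega w ⇒ distinct_ordinals w a ⇒
    ∀[C] x, in_union w a x ⇒
      ∀[C] k, k ∈ w ⇒ ∼ in_union_except w a k x ⇒
        ∃[C] y, graph a k y ⊓ x ∈ y.

(** There is an ordinal [α] with [α ∉ ω] and [ω ⊄ α]. *)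
Definition has_nonclassical_ordinal : H :=
  ∃[C] α w, ordinal α ⊓ is_omega w ⊓ α ∉ w ⊓ ∼ subset w α.

End SetTheory.

(** [M ⊆ N] *)
Definition subclass {H : completeHeyting} {V : structure H} (M N : cls V) : H :=
  inf (fun x : V => M x ⇒ N x).

(** [M] is transitive in [N]. *)
Definition transitive_in {H : completeHeyting} {V : structure H}
  (M N : cls V) : H :=
  ∀[M] x, ∀[N] y, y ∈ x ⇒ M y.

(** [Ord ∩ N = Ord ∩ M] *)
Definition same_ordinals {H : completeHeyting} {V : structure H}
  (N M : cls V) : H :=
  inf (fun x : V => (N x ⊓ ordinal N x) ⇔ (M x ⊓ ordinal M x)).

(** [(^ω 2)^N = (^ω 2)^M], as an equality of collections of functions. *)
Definition same_cantor {H : completeHeyting} {V : structure H}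
  (N M : cls V) : H :=
  inf (fun x : V => (N x ⊓ cantor N x) ⇔ (M x ⊓ cantor M x)).

(* Main.v *)
Require Import Defs.
From Stdlib Require Fin.

(** In [M] excluded middle fails: under excluded middle an ordinal [α] would
    satisfy [α ∈ ω] or [ω ⊆ α].  For [n ∈ ω] let [c n] be the set of transitive
    subsets of [n ∪ {n}].  It is an ordinal, it determines [n], and it is not
    included in [ω], since it contains all subsets of [1].  For [X ⊆ ω] in [N]
    the set [β = {x ⊆ ω | x transitive} ∪ {c n | n ∈ X}] is an ordinal of [N],
    hence lies in [M], and [n ∈ X] iff [c n ∈ β]; so [X] lies in [M].  A function
    [f : ω → 2] is recovered from the preimages of [0] and [1].  Likewise
    [ω^N], being an ordinal, lies in [M] and equals [ω^M].

    A statement [φ] is proved "at stage [p]", [p ⊩ φ] meaning that [p] is below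
    the truth value of [φ]; the introduction and elimination rules of
    intuitionistic logic then hold at all stages simultaneously. *)

Notation "p ⊩ φ" := (le p φ) (at level 97, no associativity) : heyting_scope.

(** * Rules of intuitionistic logic at a stage *)

Section Forcing.

Context {H : completeHeyting}.
Implicit Types p q r a b : H.

Lemma valid_forced {a} : valid a -> forall p, p ⊩ a.
Proof. intros h p; exact (le_trans _ _ _ _ (le_top _ p) h). Qed.

(** Among the stages below [p] that force [a] there is a largest one, [p ⊓ a], and the premise is
    needed only there. *)
Lemma imp_i {p a b} : (forall q, q ⊩ p -> q ⊩ a -> q ⊩ b) -> p ⊩ a ⇒ b.
Proof.
intros h; apply le_imp.
destruct (proj1 (le_meet _ p a (p ⊓ a)) (le_refl _ _)); auto.
Qed.

Lemma imp_e {p a b} : p ⊩ (a ⇒ b) -> p ⊩ a -> p ⊩ b.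
Proof.
intros h ha; apply le_imp in h; refine (le_trans _ _ _ _ _ h).
apply le_meet; split; [apply le_refl | exact ha].
Qed.

Lemma and_i {p a b} : p ⊩ a -> p ⊩ b -> p ⊩ a ⊓ b.
Proof. intros; apply le_meet; auto. Qed.

Lemma and_e1 {p a b} : p ⊩ a ⊓ b -> p ⊩ a.
Proof. intros h; apply le_meet in h; tauto. Qed.

Lemma and_e2 {p a b} : p ⊩ a ⊓ b -> p ⊩ b.
Proof. intros h; apply le_meet in h; tauto. Qed.

Lemma or_i1 {p a b} : p ⊩ a -> p ⊩ a ⊔ b.
Proof.
intros h; refine (le_trans _ _ _ _ h _).
exact (proj1 (proj1 (join_le _ a b _) (le_refl _ _))).
Qed.

Lemma or_i2 {p a b} : p ⊩ b -> p ⊩ a ⊔ b.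
Proof.
intros h; refine (le_trans _ _ _ _ h _).
exact (proj2 (proj1 (join_le _ a b _) (le_refl _ _))).
Qed.

(** Bounding both disjuncts by [p ⇒ r] instead of [r] keeps the stage [p] available in each case;
    this is the distributive law of a Heyting algebra. *)
Lemma or_e {p a b r} : p ⊩ a ⊔ b ->
  (forall q, q ⊩ p -> q ⊩ a -> q ⊩ r) ->
  (forall q, q ⊩ p -> q ⊩ b -> q ⊩ r) -> p ⊩ r.
Proof.
intros h ha hb.
assert (h' : p ⊩ p ⇒ r).
{ refine (le_trans _ _ _ _ h _); apply join_le; split;
    apply imp_i; intros q hq hp; eauto. }
exact (imp_e h' (le_refl _ p)).
Qed.

Lemma bot_e {p r} : p ⊩ ⊥ -> p ⊩ r.
Proof. intros h; exact (le_trans _ _ _ _ h (le_bot _ r)). Qed.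

Context {V : structure H}.
Implicit Types (C : cls V) (P : V -> H).

Lemma all_i {p C P} :
  (forall x q, q ⊩ p -> q ⊩ C x -> q ⊩ P x) -> p ⊩ all C P.
Proof. intros h; apply le_inf; intros x; apply imp_i; auto. Qed.

Lemma all_e {p C P x} : p ⊩ all C P -> p ⊩ C x -> p ⊩ P x.
Proof. intros h; exact (imp_e (proj1 (le_inf _ _ _ _) h x)). Qed.

Lemma ex_i {p C P} x : p ⊩ C x -> p ⊩ P x -> p ⊩ ex C P.
Proof.
intros hC hP; refine (le_trans _ _ _ _ (and_i hC hP) _).
exact (proj1 (sup_le _ _ (fun x => C x ⊓ P x) _) (le_refl _ _) x).
Qed.

(** Same device as in [or_e], now giving distributivity over arbitrary suprema. *)
Lemma ex_e {p C P r} : p ⊩ ex C P ->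
  (forall x q, q ⊩ p -> q ⊩ C x -> q ⊩ P x -> q ⊩ r) -> p ⊩ r.
Proof.
intros h hr.
assert (h' : p ⊩ p ⇒ r).
{ refine (le_trans _ _ _ _ h _); apply sup_le; intros x.
  apply imp_i; intros q hq hp.
  exact (hr x q hp (and_e1 hq) (and_e2 hq)). }
exact (imp_e h' (le_refl _ p)).
Qed.

End Forcing.

(** * Tactics for reasoning at a stage *)

(** Moves every hypothesis forced by [p] to the stronger stage [q]. *)
Ltac weaken hq :=
  match type of hq with
  | le ?q ?p =>
    repeat match goal with
    | h : le p _ |- _ => apply (le_trans _ _ _ _ hq) in h
    end; clear hq; try clear p
  end.

Tactic Notation "hall" ident(x) ident(hC) :=
  let q := fresh "p" in let hq := fresh in
  apply all_i; intros x q hq hC; weaken hq; try rename q into p; cbv beta in *.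

Tactic Notation "himp" ident(h) :=
  let q := fresh "p" in let hq := fresh in
  apply imp_i; intros q hq h; weaken hq; try rename q into p; cbv beta in *.

Tactic Notation "hex" constr(h) "as" ident(x) ident(hC) ident(hP) :=
  let q := fresh "p" in let hq := fresh in
  apply (ex_e h); intros x q hq hC hP; weaken hq; try rename q into p; cbv beta in *.

Tactic Notation "hor" constr(h) "as" ident(h1) :=
  let q := fresh "p" in let hq := fresh in
  apply (or_e h); intros q hq h1; weaken hq; try rename q into p; cbv beta in *.

Tactic Notation "hand" hyp(h) "as" ident(h1) ident(h2) :=
  let k := fresh in rename h into k;
  pose proof (and_e1 k) as h1; pose proof (and_e2 k) as h2; clear k;
  cbv beta in h1, h2.

(** Backtracking search: if [t] does not fit the goal, one more implication or quantifier is
    eliminated, at most [n] times. Unification sees through defined notions such as [subset]. *)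
Ltac use_depth n t :=
  first
  [ refine t
  | lazymatch n with
    | O => fail
    | S ?n => first
        [ use_depth n uconstr:(imp_e t _)
        | use_depth n uconstr:(all_e t _) ]
    end ].

(** Side conditions whose subject is still an evar are left for the second
    pass, when the other premises have determined it. *)
Ltac close_ground :=
  try lazymatch goal with
  | |- le _ (inC _ ?x) => tryif is_evar x then fail else eassumption
  | _ => eassumption
  end.

(** [use h] applies a forced chain of universal quantifications and
    implications. *)
Ltac use h :=
  use_depth 8 h; cbv beta; close_ground; close_ground.

(** * Equality and satisfaction *)

Section Basics.

Context {H : completeHeyting} {V : structure H} (C : cls V).
Implicit Types (p : H) (a b c x y z s : V).

Lemma eq_refl_f {p x} : p ⊩ x ≐ x.
Proof. exact (valid_forced (eqv_refl _ _ x) p). Qed.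

Lemma eq_sym_f {p x y} : p ⊩ x ≐ y -> p ⊩ y ≐ x.
Proof. exact (imp_e (valid_forced (eqv_sym _ _ x y) p)). Qed.

Lemma eq_trans_f {p x y z} : p ⊩ x ≐ y -> p ⊩ y ≐ z -> p ⊩ x ≐ z.
Proof.
intros h; exact (imp_e (imp_e (valid_forced (eqv_trans _ _ x y z) p) h)).
Qed.

Lemma mem_eq {p x x' y y'} :
  p ⊩ x ≐ x' -> p ⊩ y ≐ y' -> p ⊩ x ∈ y -> p ⊩ x' ∈ y'.
Proof.
intros hx hy.
exact (imp_e (imp_e (imp_e (valid_forced (mem_eqv _ _ x x' y y') p) hx) hy)).
Qed.

Lemma mem_eql {p x x' y} : p ⊩ x ≐ x' -> p ⊩ x ∈ y -> p ⊩ x' ∈ y.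
Proof. intros h; exact (mem_eq h eq_refl_f). Qed.

Lemma mem_eqr {p x y y'} : p ⊩ y ≐ y' -> p ⊩ x ∈ y -> p ⊩ x ∈ y'.
Proof. intros h; exact (mem_eq eq_refl_f h). Qed.

Lemma cls_eq {p x y} : p ⊩ x ≐ y -> p ⊩ C x -> p ⊩ C y.
Proof. intros h; exact (imp_e (imp_e (valid_forced (inC_eqv _ C x y) p) h)). Qed.

(** Induction on the formula. Stage and environments stay general, because quantifiers extend the
    environments, while implication lowers the stage and exchanges the two environments in its
    premise. *)
Lemma sat_eq n (φ : formula n) p (e e' : Fin.t n -> V) :
  (forall i, p ⊩ e i ≐ e' i) -> p ⊩ sat C φ e -> p ⊩ sat C φ e'.
Proof.
assert (hext : forall n q r x (f f' : Fin.t n -> V), r ⊩ q ->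
  (forall i, q ⊩ f i ≐ f' i) -> forall i, r ⊩ ext x f i ≐ ext x f' i).
{ intros m q r x f f' hr hf i; apply (Fin.caseS' i); cbn.
  - apply eq_refl_f.
  - intros j; exact (le_trans _ _ _ _ hr (hf j)). }
revert p e e'; induction φ as [n i j|n i j|n|n φ1 IH1 φ2 IH2|n φ1 IH1 φ2 IH2
  |n φ1 IH1 φ2 IH2|n φ IH|n φ IH]; intros p e e' he h; cbn in *.
- exact (mem_eq (he i) (he j) h).
- exact (eq_trans_f (eq_sym_f (he i)) (eq_trans_f h (he j))).
- exact h.
- exact (and_i (IH1 _ _ _ he (and_e1 h)) (IH2 _ _ _ he (and_e2 h))).
- apply (or_e h); intros q hq hq'.
  + apply or_i1, (IH1 q e e'); eauto using le_trans.
  + apply or_i2, (IH2 q e e'); eauto using le_trans.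
- apply imp_i; intros q hq h1; apply (IH2 q e e'); eauto using le_trans.
  apply (imp_e (le_trans _ _ _ _ hq h)), (IH1 q e' e); auto.
  intros i; apply eq_sym_f; eauto using le_trans.
- apply all_i; intros x q hq hx.
  apply (IH q (ext x e) (ext x e')); eauto.
  exact (all_e (le_trans _ _ _ _ hq h) hx).
- apply (ex_e h); intros x q hq hx hP; apply (ex_i x hx).
  apply (IH q (ext x e) (ext x e')); eauto.
Qed.

Definition enil : Fin.t 0 -> V := Fin.case0 (fun _ => V).

Lemma params_nil {p} : p ⊩ inf (fun i => C (enil i)).
Proof. apply le_inf; intros i; exact (Fin.case0 (fun i => p ⊩ C (enil i)) i). Qed.

Lemma params_ext {p n x} {e : Fin.t n -> V} :
  p ⊩ C x -> p ⊩ inf (fun i => C (e i)) -> p ⊩ inf (fun i => C (ext x e i)).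
Proof.
intros hx he; apply le_inf; intros i; apply (Fin.caseS' i); cbn; auto.
intros j; exact (proj1 (le_inf _ _ _ _) he j).
Qed.

End Basics.

(** * Formal counterparts of the set-theoretic notions, for use in the schemes *)

Section Formulas.

Import Fin.
Context {n : nat}.
Implicit Types i j k : Fin.t n.

Definition fIff {m} (φ ψ : formula m) := FAnd m (FImp m φ ψ) (FImp m ψ φ).

Definition fSubset i j : formula n :=
  FAll _ (FImp _ (FMem _ F1 (FS i)) (FMem _ F1 (FS j))).

Definition fPair i j k : formula n :=
  FAll _ (fIff (FMem _ F1 (FS k)) (FOr _ (FEq _ F1 (FS i)) (FEq _ F1 (FS j)))).

End Formulas.

Definition fTransitive {n} (i : Fin.t n) : formula n :=
  FAll _ (FImp _ (FMem _ Fin.F1 (Fin.FS i)) (fSubset Fin.F1 (Fin.FS i))).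

Definition fOpair {n} (i j k : Fin.t n) : formula n :=
  let w l := Fin.FS (Fin.FS l) in
  let s := Fin.FS Fin.F1 in let t := Fin.F1 in
  FEx _ (FEx _ (FAnd _ (fPair (w i) (w i) s)
    (FAnd _ (fPair (w i) (w j) t) (fPair s t (w k))))).

Definition fGraph {n} (f i j : Fin.t n) : formula n :=
  FEx _ (FAnd _ (fOpair (Fin.FS i) (Fin.FS j) Fin.F1)
    (FMem _ Fin.F1 (Fin.FS f))).

(** [c] is the ordinal written [c m] in the introduction. *)
Definition is_code {H : completeHeyting} {V : structure H} (C : cls V)
  (m c : V) : H :=
  ∀[C] x, x ∈ c ⇔ (transitive C x ⊓ (∀[C] y, y ∈ x ⇒ y ∈ m ⊔ y ≐ m)).

Definition fCode {n} (m c : Fin.t n) : formula n :=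
  FAll _ (fIff (FMem _ Fin.F1 (Fin.FS c)) (FAnd _ (fTransitive Fin.F1)
    (FAll _ (FImp _ (FMem _ Fin.F1 (Fin.FS Fin.F1))
      (FOr _ (FMem _ Fin.F1 (Fin.FS (Fin.FS m)))
        (FEq _ Fin.F1 (Fin.FS (Fin.FS m)))))))).

Notation v0 := (Fin.F1).
Notation v1 := (Fin.FS Fin.F1).
Notation v2 := (Fin.FS v1).
Notation v3 := (Fin.FS v2).
Notation v4 := (Fin.FS v3).

(** * Consequences of [IZF] within one class *)

Section Consequences.

Context {H : completeHeyting} {V : structure H} (C : cls V) (izf : IZF C).
Implicit Types (p : H) (a b c m n o s u w x y z : V).

Lemma sat_eq_hd k (φ : formula (S k)) {p x x'} {e : Fin.t k -> V} :
  p ⊩ x ≐ x' -> p ⊩ sat C φ (ext x e) -> p ⊩ sat C φ (ext x' e).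
Proof.
intros hx; apply sat_eq; intros i; apply (Fin.caseS' i); cbn; auto.
intros j; apply eq_refl_f.
Qed.

(** Lets Separation be used with a predicate [P] on the structure, [φ] only certifying that [P] is
    definable from the parameters [e]. For a suitable [φ] the agreement of the two holds by
    computation. *)
Lemma sep {k} (φ : formula (S k)) (e : Fin.t k -> V) (P : V -> H) :
  (forall x, sat C φ (ext x e) = P x) -> forall p a,
  p ⊩ inf (fun i => C (e i)) -> p ⊩ C a ->
  p ⊩ (∃[C] b, ∀[C] x, x ∈ b ⇔ x ∈ a ⊓ P x).
Proof.
intros hP p a he ha.
pose proof (imp_e (proj1 (le_inf _ _ _ _)
  (valid_forced (separation _ izf k φ) p) e) he) as h.
hex (all_e h ha) as b hb hx; apply (ex_i b hb).
hall x hC; rewrite <- hP; exact (all_e hx hC).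
Qed.

Lemma ind {k} (φ : formula (S k)) (e : Fin.t k -> V) (P : V -> H) :
  (forall x, sat C φ (ext x e) = P x) -> forall p,
  p ⊩ inf (fun i => C (e i)) ->
  p ⊩ (∀[C] a, (∀[C] x, x ∈ a ⇒ P x) ⇒ P a) ->
  p ⊩ (∀[C] a, P a).
Proof.
intros hP p he hs.
pose proof (imp_e (proj1 (le_inf _ _ _ _)
  (valid_forced (set_induction _ izf k φ) p) e) he) as h.
hall a ha; rewrite <- hP; use h.
hall b hb; himp hi; rewrite hP; use hs.
hall x hx; himp hxb; rewrite <- hP; use hi.
Qed.

Lemma ext_eq {p a b} : p ⊩ C a -> p ⊩ C b ->
  p ⊩ (∀[C] x, x ∈ a ⇒ x ∈ b) -> p ⊩ (∀[C] x, x ∈ b ⇒ x ∈ a) -> p ⊩ a ≐ b.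
Proof.
intros ha hb h1 h2; use (valid_forced (extensionality _ izf) p).
hall x hx; apply and_i; himp h; [use h1|use h2].
Qed.

(** Set induction: if [a ∈ a], the induction hypothesis applies to [a] itself and refutes this. *)
Lemma mem_irrefl {p x r} : p ⊩ C x -> p ⊩ x ∈ x -> p ⊩ r.
Proof.
intros hC hx; apply bot_e.
assert (h : p ⊩ (∀[C] x, x ∉ x)).
{ apply (ind (FImp _ (FMem _ v0 v0) (FBot _)) enil (fun x => x ∉ x)).
  - reflexivity.
  - apply params_nil.
  - hall a ha; himp hi; himp h; pose proof h as h'; use hi. }
use h.
Qed.

Lemma powerset {p a} : p ⊩ C a ->
  p ⊩ (∃[C] b, ∀[C] x, x ∈ b ⇔ subset C x a).
Proof. intros ha; exact (all_e (valid_forced (power_set _ izf) p) ha). Qed.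

(** * Induction on ω and its transitivity *)

Section Omega.

Context {w : V}.

Lemma omega_zero {p} : p ⊩ is_omega C w -> p ⊩ (∃[C] o, is_empty C o ⊓ o ∈ w).
Proof. intros h; exact (and_e1 (and_e1 h)). Qed.

Lemma omega_succ {p x} : p ⊩ is_omega C w -> p ⊩ C x -> p ⊩ x ∈ w ->
  p ⊩ (∃[C] s, is_succ C x s ⊓ s ∈ w).
Proof. intros h hC; exact (imp_e (all_e (and_e2 (and_e1 h)) hC)). Qed.

(** The subset of [w] cut out by [P] is inductive, so minimality of [w] makes it all of [w]. *)
Lemma omega_ind {k} (φ : formula (S k)) (e : Fin.t k -> V) (P : V -> H) :
  (forall x, sat C φ (ext x e) = P x) -> forall p,
  p ⊩ is_omega C w -> p ⊩ C w -> p ⊩ inf (fun i => C (e i)) ->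
  p ⊩ (∀[C] o, is_empty C o ⇒ o ∈ w ⇒ P o) ->
  p ⊩ (∀[C] x s, x ∈ w ⇒ P x ⇒ is_succ C x s ⇒ s ∈ w ⇒ P s) ->
  p ⊩ (∀[C] x, x ∈ w ⇒ P x).
Proof.
intros hP p hw hC he h0 hs.
hex (sep φ e P hP p w he hC) as b hb hxb.
assert (hi : p ⊩ inductive C b).
{ apply and_i.
  - hex (omega_zero hw) as o ho ho2; hand ho2 as ho2 ho3.
    apply (ex_i o ho), and_i; auto.
    use (and_e2 (all_e hxb ho)); apply and_i; auto; use h0.
  - hall x hx; himp hx2.
    pose proof (imp_e (and_e1 (all_e hxb hx)) hx2) as hx3; hand hx3 as hx3 hx4.
    hex (omega_succ hw hx hx3) as s hsC hs2; hand hs2 as hs2 hs3.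
    apply (ex_i s hsC), and_i; auto.
    use (and_e2 (all_e hxb hsC)); apply and_i; auto.
    use (all_e hs hx). }
pose proof (imp_e (all_e (and_e2 hw) hb) hi) as hwb.
hall x hx; himp hx2; apply (@and_e2 _ _ (x ∈ w)).
use (and_e1 (all_e hxb hx)); use hwb.
Qed.

Lemma omega_transitive {p} : p ⊩ is_omega C w -> p ⊩ C w -> p ⊩ transitive C w.
Proof.
intros hw hC.
apply (omega_ind (fSubset v0 v1) (ext w enil) (fun x => subset C x w)); auto.
- apply params_ext; auto; apply params_nil.
- hall o ho; himp he; himp ho2; hall z hz; himp hz2; apply bot_e; use he.
- hall x hx; hall s hs; himp hxw; himp hi; himp hsc; himp hsw; hall z hz; himp hzs.
  hor (imp_e (and_e1 (all_e hsc hz)) hzs) as h; [use hi|].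
  exact (mem_eql (eq_sym_f h) hxw).
Qed.

Lemma succ_intro_l {p x s z} : p ⊩ is_succ C x s -> p ⊩ C z -> p ⊩ z ∈ x -> p ⊩ z ∈ s.
Proof. intros h hz hzx; use (and_e2 (all_e h hz)); apply or_i1, hzx. Qed.

Lemma succ_intro_r {p x s} : p ⊩ is_succ C x s -> p ⊩ C x -> p ⊩ x ∈ s.
Proof. intros h hz; use (and_e2 (all_e h hz)); apply or_i2, eq_refl_f. Qed.

Lemma succ_elim {p x s z} : p ⊩ is_succ C x s -> p ⊩ C z -> p ⊩ z ∈ s ->
  p ⊩ z ∈ x ⊔ z ≐ x.
Proof. intros h hz; exact (imp_e (and_e1 (all_e h hz))). Qed.

Lemma omega_mem_transitive {p} : p ⊩ is_omega C w -> p ⊩ C w ->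
  p ⊩ (∀[C] x, x ∈ w ⇒ transitive C x).
Proof.
intros hw hC.
apply (omega_ind (fTransitive v0) enil (fun x => transitive C x)); auto.
- apply params_nil.
- hall o ho; himp he; himp ho2; hall z hz; himp hz2; apply bot_e; use he.
- hall x hx; hall s hs; himp hxw; himp hi; himp hsc; himp hsw; hall z hz; himp hzs.
  hall y hy; himp hyz; apply (succ_intro_l hsc hy).
  hor (succ_elim hsc hz hzs) as h; [|exact (mem_eqr h hyz)].
  use hi; eassumption.
Qed.

Lemma omega_ordinal {p} : p ⊩ is_omega C w -> p ⊩ C w -> p ⊩ ordinal C w.
Proof.
intros; apply and_i; [apply omega_transitive|apply omega_mem_transitive]; auto.
Qed.

End Omega.


(** * Excluded middle for membership and ordinals *)

Section Decidability.

Context {w : V}.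

Lemma empty_unique {p x y} : p ⊩ C x -> p ⊩ C y ->
  p ⊩ is_empty C x -> p ⊩ is_empty C y -> p ⊩ x ≐ y.
Proof.
intros hx hy h1 h2; apply ext_eq; auto;
  hall z hz; himp h; apply bot_e; [use h1|use h2].
Qed.

(** Being zero is decidable on ω even intuitionistically, since every successor contains zero. *)
Lemma omega_zero_cases {p o} : p ⊩ is_omega C w -> p ⊩ C w ->
  p ⊩ C o -> p ⊩ is_empty C o ->
  p ⊩ (∀[C] x, x ∈ w ⇒ (o ∈ x ⊔ x ≐ o)).
Proof.
intros hw hC ho he.
apply (omega_ind (FOr _ (FMem _ v1 v0) (FEq _ v0 v1)) (ext o enil)
  (fun x => o ∈ x ⊔ x ≐ o)); auto.
- apply params_ext; auto; apply params_nil.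
- hall o' ho'; himp he'; himp hw'; apply or_i2, empty_unique; auto.
- hall x hx; hall s hs; himp hxw; himp hi; himp hsc; himp hsw; apply or_i1.
  hor hi as h; [exact (succ_intro_l hsc ho h)|].
  exact (mem_eql h (succ_intro_r hsc hx)).
Qed.

(* Membership [y ∈ x] is decided by the truth value [{0 | y ∈ x}], a
   transitive subset of every [n ∪ {n}]. *)
Lemma code_subset_omega_lem {p n c} : p ⊩ is_omega C w -> p ⊩ C w ->
  p ⊩ C n -> p ⊩ n ∈ w -> p ⊩ C c -> p ⊩ is_code C n c -> p ⊩ subset C c w ->
  p ⊩ (∀[C] x y, y ∈ x ⊔ y ∉ x).
Proof.
intros hw hC hn hnw hc hcode hcw; hall x hx; hall y hy.
hex (omega_zero hw) as o ho ho2; hand ho2 as he how.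
hex (sep (FAnd _ (FEq _ v0 v1) (FMem _ v2 v3)) (ext o (ext y (ext x enil)))
  (fun z => z ≐ o ⊓ y ∈ x) (fun _ => eq_refl) _ w
  (params_ext C ho (params_ext C hy (params_ext C hx (params_nil C)))) hC)
  as u hu hmem.
assert (huo : p ⊩ (∀[C] z, z ∈ u ⇒ z ≐ o ⊓ y ∈ x)).
{ hall z hz; himp h; exact (and_e2 (imp_e (and_e1 (all_e hmem hz)) h)). }
assert (huc : p ⊩ u ∈ c).
{ use (and_e2 (all_e hcode hu)); apply and_i.
  - hall z hz; himp hzu; hall t ht; himp htz; apply bot_e.
    use (all_e he ht); use (mem_eqr (and_e1 (imp_e (all_e huo hz) hzu)) htz).
  - hall z hz; himp hzu.
    pose proof (and_e1 (imp_e (all_e huo hz) hzu)) as hzo.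
    hor (imp_e (all_e (omega_zero_cases hw hC ho he) hn) hnw) as h.
    + exact (or_i1 (mem_eql (eq_sym_f hzo) h)).
    + exact (or_i2 (eq_trans_f hzo (eq_sym_f h))). }
assert (huw : p ⊩ u ∈ w) by (use hcw).
hor (imp_e (all_e (omega_zero_cases hw hC ho he) hu) huw) as h.
(* As an element of ω, [u] either contains [o], and then [y ∈ x], or equals [o], and then [y ∈ x]
   would put an element into the empty set. *)
- apply or_i1; exact (and_e2 (imp_e (all_e huo ho) h)).
- apply or_i2; himp hyx; use (all_e he ho); apply (mem_eqr h).
  use (and_e2 (all_e hmem ho)); apply and_i; auto.
  apply and_i; auto; apply eq_refl_f.
Qed.

(** Induction on [n]. A transitive subset [x] of the successor [s] of [n] either contains [n], hence
    is all of [s], or is already a subset of [n]; [hlem] decides which. *)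
Lemma lem_transitive_subset_omega {p} : p ⊩ is_omega C w -> p ⊩ C w ->
  p ⊩ (∀[C] x y, y ∈ x ⊔ y ∉ x) ->
  p ⊩ (∀[C] n, n ∈ w ⇒ ∀[C] x, transitive C x ⇒ subset C x n ⇒ x ∈ n ⊔ x ≐ n).
Proof.
intros hw hC hlem.
apply (omega_ind (FAll _ (FImp _ (fTransitive v0) (FImp _ (fSubset v0 v1)
    (FOr _ (FMem _ v0 v1) (FEq _ v0 v1))))) enil
  (fun n => ∀[C] x, transitive C x ⇒ subset C x n ⇒ x ∈ n ⊔ x ≐ n)); auto.
- apply params_nil.
- hall o ho; himp he; himp how; hall x hx; himp ht; himp hxo.
  apply or_i2, ext_eq; auto.
  hall z hz; himp h; apply bot_e; use he.
- hall n hn; hall s hs; himp hnw; himp hi; himp hsc; himp hsw.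
  hall x hx; himp ht; himp hxs.
  hor (all_e (all_e hlem hx) hn) as h.
  + apply or_i2, ext_eq; auto.
    hall z hz; himp hzs; hor (succ_elim hsc hz hzs) as h1.
    * use (imp_e (all_e ht hn) h).
    * exact (mem_eql (eq_sym_f h1) h).
  + apply or_i1.
    assert (hxn : p ⊩ subset C x n).
    { hall z hz; himp hzx.
      assert (hzs : p ⊩ z ∈ s) by (use hxs).
      hor (succ_elim hsc hz hzs) as h1; auto.
      apply bot_e; use h; exact (mem_eql h1 hzx). }
    assert (hor : p ⊩ x ∈ n ⊔ x ≐ n) by (use hi).
    hor hor as h1.
    * exact (succ_intro_l hsc hx h1).
    * exact (mem_eql (eq_sym_f h1) (succ_intro_r hsc hn)).
Qed.

End Decidability.

(** If some [n ∈ w] were not in [α], then [α ⊆ n], so [α] would be an element of [n] or [n] itself,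
    against [α ∉ w]. Hence [w ⊆ α], which is excluded too. *)
Lemma lem_not_nonclassical {p r} :
  p ⊩ (∀[C] x y, y ∈ x ⊔ y ∉ x) -> p ⊩ has_nonclassical_ordinal C -> p ⊩ r.
Proof.
intros hlem hord.
hex hord as α hα h; hex h as w hC h1.
hand h1 as hord1 h1; hand h1 as hw h1; hand h1 as hαw hwα.
apply bot_e; use hwα; hall n hn; himp hnw.
hor (all_e (all_e hlem hα) hn) as h1; auto.
(* Set induction on [x]: an element [x] of [α] whose elements lie in [n] is a transitive subset of
   [n], and it cannot be [n] because [n ∉ α]. *)
assert (hsub : p ⊩ (∀[C] x, x ∈ α ⇒ x ∈ n)).
{ apply (ind (FImp _ (FMem _ v0 v1) (FMem _ v0 v2)) (ext α (ext n enil))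
    (fun x => x ∈ α ⇒ x ∈ n)).
  - reflexivity.
  - repeat apply params_ext; auto; apply params_nil.
  - hall x hx; himp hi; himp hxα.
    assert (hxn : p ⊩ subset C x n).
    { hall y hy; himp hyx; use (all_e hi hy).
      use (and_e1 hord1). }
    assert (hxt : p ⊩ transitive C x) by (use (and_e2 hord1)).
    hor (imp_e (imp_e (all_e (imp_e (all_e
      (lem_transitive_subset_omega hw hC hlem) hn) hnw) hx) hxt) hxn) as h2; auto.
    apply bot_e; use h1; exact (mem_eql h2 hxα). }
apply bot_e; use hαw.
hor (imp_e (imp_e (all_e (imp_e (all_e
  (lem_transitive_subset_omega hw hC hlem) hn) hnw) hα) (and_e1 hord1)) hsub)
  as h2.
- use (imp_e (all_e (omega_transitive hw hC) hn) hnw).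
- exact (mem_eql (eq_sym_f h2) hnw).
Qed.

(** * Codes of natural numbers and of subsets of ω *)

Section Codes.

Context {w : V}.

(** The successor of [n] lies in the code of [n], so a common code gives [n ∈ m] or [n ≐ m], and
    symmetrically. Both memberships together would give [n ∈ n]. *)
Lemma code_injective {p n m c} : p ⊩ is_omega C w -> p ⊩ C w ->
  p ⊩ C n -> p ⊩ n ∈ w -> p ⊩ C m -> p ⊩ m ∈ w -> p ⊩ C c ->
  p ⊩ is_code C n c -> p ⊩ is_code C m c -> p ⊩ n ≐ m.
Proof.
intros hw hC.
assert (half : forall p k l, p ⊩ is_omega C w -> p ⊩ C w ->
  p ⊩ C k -> p ⊩ k ∈ w -> p ⊩ C l -> p ⊩ C c ->
  p ⊩ is_code C k c -> p ⊩ is_code C l c -> p ⊩ (k ∈ l ⊔ k ≐ l)).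
{ clear - izf; intros p k l hw hC hk hkw hl hc h1 h2.
  hex (omega_succ hw hk hkw) as s hs h; hand h as hsc hsw.
  assert (hsc' : p ⊩ s ∈ c).
  { use (and_e2 (all_e h1 hs)); apply and_i.
    - use (omega_mem_transitive hw hC).
    - hall y hy; himp hys; exact (succ_elim hsc hy hys). }
  use (and_e2 (imp_e (and_e1 (all_e h2 hs)) hsc')).
  exact (succ_intro_r hsc hk). }
intros hn hnw hm hmw hc h1 h2.
pose proof (half p n m hw hC hn hnw hm hc h1 h2) as hnm.
pose proof (half p m n hw hC hm hmw hn hc h2 h1) as hmn; clear half.
hor hnm as h3; auto.
hor hmn as h4; [|exact (eq_sym_f h4)].
apply (mem_irrefl hn).
use (imp_e (all_e (imp_e (all_e (omega_mem_transitive hw hC) hn) hnw) hm) h4).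
Qed.

Lemma code_exists {p n} : p ⊩ is_omega C w -> p ⊩ C w ->
  p ⊩ C n -> p ⊩ n ∈ w -> p ⊩ (∃[C] c, is_code C n c).
Proof.
intros hw hC hn hnw.
hex (powerset hC) as P hP hPm.
hex (sep (FAnd _ (fTransitive v0) (FAll _ (FImp _ (FMem _ v0 v1)
    (FOr _ (FMem _ v0 v2) (FEq _ v0 v2))))) (ext n enil)
  (fun x => transitive C x ⊓ (∀[C] y, y ∈ x ⇒ y ∈ n ⊔ y ≐ n))
  (fun _ => eq_refl) _ P (params_ext C hn (params_nil C)) hP) as c hc hm.
apply (ex_i c hc); hall x hx; apply and_i; himp h.
- exact (and_e2 (imp_e (and_e1 (all_e hm hx)) h)).
- use (and_e2 (all_e hm hx)); apply and_i; auto.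
  use (and_e2 (all_e hPm hx)); hall y hy; himp hyx.
  hor (imp_e (all_e (and_e2 h) hy) hyx) as h1.
  + use (imp_e (all_e (omega_transitive hw hC) hn) hnw).
  + exact (mem_eql (eq_sym_f h1) hnw).
Qed.

(** [b] is the ordinal [β] that codes [X]. *)
Definition is_beta (X b : V) : H :=
  ∀[C] x, x ∈ b ⇔ ((transitive C x ⊓ subset C x w) ⊔
                   (∃[C] m, m ∈ X ⊓ is_code C m x)).

(** Elements of a code satisfy the first alternative of [is_beta]; this is what makes the coding set
    transitive. *)
Lemma code_mem_subset {p n c x} : p ⊩ is_omega C w -> p ⊩ C w ->
  p ⊩ C n -> p ⊩ n ∈ w -> p ⊩ is_code C n c -> p ⊩ C x -> p ⊩ x ∈ c ->
  p ⊩ transitive C x ⊓ subset C x w.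
Proof.
intros hw hC hn hnw hc hx hxc.
pose proof (imp_e (and_e1 (all_e hc hx)) hxc) as h; hand h as ht hsub.
apply and_i; auto.
hall y hy; himp hyx.
hor (imp_e (all_e hsub hy) hyx) as h1.
- use (imp_e (all_e (omega_transitive hw hC) hn) hnw).
- exact (mem_eql (eq_sym_f h1) hnw).
Qed.

(** Separation from the second power set of [w]: a code consists of subsets of [w], and so does a
    subset of [w], by transitivity of ω. *)
Lemma beta_exists {p X} : p ⊩ is_omega C w -> p ⊩ C w ->
  p ⊩ C X -> p ⊩ subset C X w -> p ⊩ (∃[C] b, is_beta X b).
Proof.
intros hw hC hX hXw.
hex (powerset hC) as P hP hPm.
hex (powerset hP) as Q hQ hQm.
hex (sep (FOr _ (FAnd _ (fTransitive v0) (fSubset v0 v1))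
    (FEx _ (FAnd _ (FMem _ v0 v3) (fCode v0 v1)))) (ext w (ext X enil))
  (fun x => (transitive C x ⊓ subset C x w) ⊔ (∃[C] m, m ∈ X ⊓ is_code C m x))
  (fun _ => eq_refl) _ Q (params_ext C hC (params_ext C hX (params_nil C))) hQ)
  as b hb hm.
apply (ex_i b hb); hall x hx; apply and_i; himp h.
- exact (and_e2 (imp_e (and_e1 (all_e hm hx)) h)).
- use (and_e2 (all_e hm hx)); apply and_i; auto.
  use (and_e2 (all_e hQm hx)); hall y hy; himp hyx.
  use (and_e2 (all_e hPm hy)).
  hor h as h1.
  + assert (hyw : p ⊩ y ∈ w) by (use (and_e2 h1)).
    use (omega_transitive hw hC).
  + hex h1 as m hmC h2; hand h2 as hmX hcode.
    assert (hmw : p ⊩ m ∈ w) by (use hXw).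
    exact (and_e2 (code_mem_subset hw hC hmC hmw hcode hy hyx)).
Qed.

Lemma beta_ordinal {p X b} : p ⊩ is_omega C w -> p ⊩ C w ->
  p ⊩ C X -> p ⊩ subset C X w -> p ⊩ C b -> p ⊩ is_beta X b -> p ⊩ ordinal C b.
Proof.
intros hw hC hX hXw hb hbeta; apply and_i.
- hall x hx; himp hxb; hall y hy; himp hyx.
  use (and_e2 (all_e hbeta hy)); apply or_i1.
  hor (imp_e (and_e1 (all_e hbeta hx)) hxb) as h.
  + assert (hyw : p ⊩ y ∈ w) by (use (and_e2 h)).
    apply and_i; [use (omega_mem_transitive hw hC)|use (omega_transitive hw hC)].
  + hex h as m hmC h2; hand h2 as hmX hcode.
    assert (hmw : p ⊩ m ∈ w) by (use hXw).
    exact (code_mem_subset hw hC hmC hmw hcode hy hyx).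
- hall x hx; himp hxb.
  hor (imp_e (and_e1 (all_e hbeta hx)) hxb) as h; [exact (and_e1 h)|].
  hex h as m hmC h2; hand h2 as hmX hcode.
  assert (hmw : p ⊩ m ∈ w) by (use hXw).
  (* A code is transitive: an element [z] of its element [y] is a natural number, hence transitive,
     and the elements of [z] lie in the transitive set [y]. *)
  hall y hy; himp hyx; hall z hz; himp hzy.
  pose proof (and_e2 (imp_e (and_e1 (all_e hcode hy)) hyx)) as hyn.
  assert (hzw : p ⊩ z ∈ w).
  { use (and_e2 (code_mem_subset hw hC hmC hmw hcode hy hyx)). }
  use (and_e2 (all_e hcode hz)); apply and_i.
  + use (omega_mem_transitive hw hC).
  + hall t ht; himp htz.
    pose proof (and_e1 (imp_e (and_e1 (all_e hcode hy)) hyx)) as hyt.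
    use hyn; use (imp_e (all_e hyt hz) hzy).
Qed.

End Codes.

End Consequences.

(** * Ordered pairs and the elements of 2 *)

Section Pairs.

Context {H : completeHeyting} {V : structure H} (C : cls V) (izf : IZF C).
Implicit Types (p : H) (a b c f o q s t w x y z : V).

Lemma pair_l {p a b c} : p ⊩ is_pair C a b c -> p ⊩ C a -> p ⊩ a ∈ c.
Proof. intros h ha; use (and_e2 (all_e h ha)); apply or_i1, eq_refl_f. Qed.

Lemma pair_r {p a b c} : p ⊩ is_pair C a b c -> p ⊩ C b -> p ⊩ b ∈ c.
Proof. intros h hb; use (and_e2 (all_e h hb)); apply or_i2, eq_refl_f. Qed.

Lemma pair_unique {p a a' b b' c c'} : p ⊩ a ≐ a' -> p ⊩ b ≐ b' ->
  p ⊩ C c -> p ⊩ C c' -> p ⊩ is_pair C a b c -> p ⊩ is_pair C a' b' c' ->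
  p ⊩ c ≐ c'.
Proof.
intros ha hb hc hc' h h'; apply (ext_eq C izf hc hc').
- hall x hx; himp hxc; use (and_e2 (all_e h' hx)).
  hor (imp_e (and_e1 (all_e h hx)) hxc) as h1.
  + exact (or_i1 (eq_trans_f h1 ha)).
  + exact (or_i2 (eq_trans_f h1 hb)).
- hall x hx; himp hxc; use (and_e2 (all_e h hx)).
  hor (imp_e (and_e1 (all_e h' hx)) hxc) as h1.
  + exact (or_i1 (eq_trans_f h1 (eq_sym_f ha))).
  + exact (or_i2 (eq_trans_f h1 (eq_sym_f hb))).
Qed.

Lemma opair_unique {p x x' y y' q q'} : p ⊩ x ≐ x' -> p ⊩ y ≐ y' ->
  p ⊩ C q -> p ⊩ C q' -> p ⊩ is_opair C x y q -> p ⊩ is_opair C x' y' q' ->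
  p ⊩ q ≐ q'.
Proof.
intros hx hy hq hq' h h'.
hex h as s hs h1; hex h1 as t ht h2; hex h' as s' hs' h3; hex h3 as t' ht' h4.
hand h2 as ha h2; hand h2 as hb h2; hand h4 as ha' h4; hand h4 as hb' h4.
exact (pair_unique (pair_unique hx hx hs hs' ha ha')
  (pair_unique hx hy ht ht' hb hb') hq hq' h2 h4).
Qed.

Lemma opair_exists {p x y} : p ⊩ C x -> p ⊩ C y -> p ⊩ (∃[C] q, is_opair C x y q).
Proof.
intros hx hy; pose proof (valid_forced (pairing _ izf) p) as h.
hex (all_e (all_e h hx) hx) as s hs h1.
hex (all_e (all_e h hx) hy) as t ht h2.
hex (all_e (all_e h hs) ht) as q hq h3.
apply (ex_i q hq), (ex_i s hs), (ex_i t ht), and_i; [|apply and_i]; auto.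
Qed.

(** Congruence comes from reading [graph] as the satisfaction of [fGraph]. *)
Lemma graph_eq {p f x y y'} : p ⊩ y ≐ y' -> p ⊩ graph C f x y -> p ⊩ graph C f x y'.
Proof. exact (@sat_eq_hd _ _ C 2 (fGraph v1 v2 v0) p y y' (ext f (ext x enil))). Qed.

(** The condition that [is_two] puts on elements, isolated so that it can be used without a set 2 at
    hand. *)
Definition is_bit x : H :=
  is_empty C x ⊔ (∃[C] o, is_empty C o ⊓ is_succ C o x).

Lemma succ_unique {p x x' s s'} : p ⊩ x ≐ x' -> p ⊩ C s -> p ⊩ C s' ->
  p ⊩ is_succ C x s -> p ⊩ is_succ C x' s' -> p ⊩ s ≐ s'.
Proof.
intros hx hs hs' h h'; apply (ext_eq C izf hs hs').
- hall z hz; himp hzs; use (and_e2 (all_e h' hz)).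
  hor (succ_elim C h hz hzs) as h1.
  + exact (or_i1 (mem_eqr hx h1)).
  + exact (or_i2 (eq_trans_f h1 hx)).
- hall z hz; himp hzs; use (and_e2 (all_e h hz)).
  hor (succ_elim C h' hz hzs) as h1.
  + exact (or_i1 (mem_eqr (eq_sym_f hx) h1)).
  + exact (or_i2 (eq_trans_f h1 (eq_sym_f hx))).
Qed.

Lemma bit_cases {p x z0 z1} : p ⊩ C x -> p ⊩ C z0 -> p ⊩ C z1 ->
  p ⊩ is_empty C z0 -> p ⊩ is_succ C z0 z1 -> p ⊩ is_bit x ->
  p ⊩ x ≐ z0 ⊔ x ≐ z1.
Proof.
intros hx h0 h1 he hs h; hor h as h2.
- apply or_i1, (empty_unique C izf); auto.
- hex h2 as o ho h3; hand h3 as heo hso; apply or_i2.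
  exact (succ_unique (empty_unique C izf ho h0 heo he) hx h1 hso hs).
Qed.

Lemma bit_in_omega {p w x} : p ⊩ is_omega C w -> p ⊩ C w -> p ⊩ C x ->
  p ⊩ is_bit x -> p ⊩ x ∈ w.
Proof.
intros hw hC hx h.
hex (omega_zero C hw) as z0 h0 h1; hand h1 as he h0w.
hex (omega_succ C hw h0 h0w) as z1 h1 h2; hand h2 as hs h1w.
hor (bit_cases hx h0 h1 he hs h) as h2.
- exact (mem_eql (eq_sym_f h2) h0w).
- exact (mem_eql (eq_sym_f h2) h1w).
Qed.

End Pairs.

(** * Absoluteness between [M] and [N] *)

Section Absoluteness.

Context {H : completeHeyting} {V : structure H} (M N : cls V)
  (MsubN : valid (subclass M N)) (Mtrans : valid (transitive_in M N)).
Implicit Types (p : H) (a b c d f m n o q s t w x y z : V) (P : V -> H).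

Lemma up {p x} : p ⊩ M x -> p ⊩ N x.
Proof. exact (imp_e (proj1 (le_inf _ _ _ _) (valid_forced MsubN p) x)). Qed.

Lemma down {p x y} : p ⊩ M x -> p ⊩ N y -> p ⊩ y ∈ x -> p ⊩ M y.
Proof.
intros hx hy; exact (imp_e (all_e (all_e (valid_forced Mtrans p) hx) hy)).
Qed.

Lemma all_down {p P} : p ⊩ all N P -> p ⊩ all M P.
Proof. intros h; hall x hx; exact (all_e h (up hx)). Qed.

(** Passing from [M] to [N] adds no elements to [a], because [M] is transitive in [N]. *)
Lemma all_mem_up {p a P} : p ⊩ M a ->
  p ⊩ (∀[M] x, x ∈ a ⇒ P x) -> p ⊩ (∀[N] x, x ∈ a ⇒ P x).
Proof. intros ha h; hall x hx; himp hxa; use h; exact (down ha hx hxa). Qed.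

Lemma transitive_down {p a} : p ⊩ transitive N a -> p ⊩ transitive M a.
Proof. intros h; hall x hx; himp hxa; apply all_down; exact (imp_e (all_e h (up hx)) hxa). Qed.

Lemma transitive_up {p a} : p ⊩ M a -> p ⊩ transitive M a -> p ⊩ transitive N a.
Proof.
intros ha h; apply (all_mem_up ha); hall x hx; himp hxa.
apply (all_mem_up hx); exact (imp_e (all_e h hx) hxa).
Qed.

(** The condition on [x] has only bounded quantifiers, so [M] and [N] agree on it for [x] in [M];
    the outer quantifier over [x] is unbounded and only passes down. *)
Lemma code_down {p n c} : p ⊩ is_code N n c -> p ⊩ is_code M n c.
Proof.
intros h; hall x hx; apply and_i; himp h1.
- pose proof (imp_e (and_e1 (all_e h (up hx))) h1) as h2; hand h2 as h2 h3.
  apply and_i; [apply transitive_down | apply all_down]; auto.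
- hand h1 as h1 h2; use (and_e2 (all_e h (up hx))).
  apply and_i; [apply transitive_up | apply all_mem_up]; auto.
Qed.

Lemma empty_up {p a} : p ⊩ M a -> p ⊩ is_empty M a -> p ⊩ is_empty N a.
Proof. exact all_mem_up. Qed.

Lemma succ_up {p x s} : p ⊩ M x -> p ⊩ M s -> p ⊩ is_succ M x s -> p ⊩ is_succ N x s.
Proof.
intros hx hs h; hall z hz; apply and_i; himp hzs.
- use (and_e1 (all_e h (down hs hz hzs))).
- assert (hzM : p ⊩ M z).
  { hor hzs as h1; [exact (down hx hz h1)|exact (cls_eq M (eq_sym_f h1) hx)]. }
  use (and_e2 (all_e h hzM)).
Qed.

Lemma pair_up {p a b c} : p ⊩ M a -> p ⊩ M b -> p ⊩ M c ->
  p ⊩ is_pair M a b c -> p ⊩ is_pair N a b c.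
Proof.
intros ha hb hc h; hall z hz; apply and_i; himp hzc.
- use (and_e1 (all_e h (down hc hz hzc))).
- assert (hzM : p ⊩ M z).
  { hor hzc as h1; [exact (cls_eq M (eq_sym_f h1) ha)
                   |exact (cls_eq M (eq_sym_f h1) hb)]. }
  use (and_e2 (all_e h hzM)).
Qed.

Lemma opair_up {p x y q} : p ⊩ M x -> p ⊩ M y -> p ⊩ M q ->
  p ⊩ is_opair M x y q -> p ⊩ is_opair N x y q.
Proof.
intros hx hy hq h; hex h as s hs h1; hex h1 as t ht h2.
hand h2 as ha h2; hand h2 as hb h2.
apply (ex_i s (up hs)), (ex_i t (up ht)), and_i; [|apply and_i]; apply pair_up; auto.
Qed.

Lemma opair_down {p x y q} : p ⊩ M q ->
  p ⊩ is_opair N x y q -> p ⊩ is_opair M x y q.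
Proof.
intros hq h; hex h as s hs h1; hex h1 as t ht h2.
hand h2 as ha h2; hand h2 as hb h2.
apply (ex_i s (down hq hs (pair_l _ h2 hs))), (ex_i t (down hq ht (pair_r _ h2 ht))).
apply and_i; [|apply and_i]; apply all_down; auto.
Qed.

(** Both coordinates belong to the set [t], which belongs to [q]; transitivity is applied twice. *)
Lemma opair_components {p x y q} : p ⊩ N x -> p ⊩ N y -> p ⊩ M q ->
  p ⊩ is_opair N x y q -> p ⊩ M x ⊓ M y.
Proof.
intros hx hy hq h; hex h as s hs h1; hex h1 as t ht h2.
hand h2 as ha h2; hand h2 as hb h2.
pose proof (down hq ht (pair_r _ h2 ht)) as htM.
exact (and_i (down htM hx (pair_l _ hb hx)) (down htM hy (pair_r _ hb hy))).
Qed.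

Lemma graph_up {p f x y} : p ⊩ M f -> p ⊩ M x -> p ⊩ M y ->
  p ⊩ graph M f x y -> p ⊩ graph N f x y.
Proof.
intros hf hx hy h; hex h as q hq h1; hand h1 as h1 h2.
apply (ex_i q (up hq)), and_i; auto; apply opair_up; auto.
Qed.

Lemma graph_down {p f x y} : p ⊩ M f ->
  p ⊩ graph N f x y -> p ⊩ graph M f x y.
Proof.
intros hf h; hex h as q hq h1; hand h1 as h1 h2.
pose proof (down hf hq h2) as hqM.
apply (ex_i q hqM), and_i; auto; apply opair_down; auto.
Qed.

Lemma graph_components {p f x y} : p ⊩ N x -> p ⊩ N y -> p ⊩ M f ->
  p ⊩ graph N f x y -> p ⊩ M x ⊓ M y.
Proof.
intros hx hy hf h; hex h as q hq h1; hand h1 as h1 h2.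
exact (opair_components hx hy (down hf hq h2) h1).
Qed.

Lemma function_on_up {p f d} : p ⊩ M f -> p ⊩ M d ->
  p ⊩ function_on M f d -> p ⊩ function_on N f d.
Proof.
intros hf hd h; hand h as h1 h2; apply and_i.
- apply (all_mem_up hf); hall q hq; himp hqf.
  hex (imp_e (all_e h1 hq) hqf) as x hx h3; hex h3 as y hy h4; hand h4 as h4 h5.
  apply (ex_i x (up hx)), (ex_i y (up hy)), and_i; auto; apply opair_up; auto.
- apply (all_mem_up hd); hall x hx; himp hxd.
  hex (imp_e (all_e h2 hx) hxd) as y hy h3; hand h3 as h3 h4.
  apply (ex_i y (up hy)), and_i; [apply graph_up; auto|].
  (* A competing value [z] from [N] is a coordinate of a pair in [f], hence already in [M]. *)
  hall z hz; himp h5.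
  pose proof (and_e2 (graph_components (up hx) hz hf h5)) as hzM.
  use h4; exact (graph_down hf h5).
Qed.

Lemma function_on_down {p f d} : p ⊩ M f ->
  p ⊩ function_on N f d -> p ⊩ function_on M f d.
Proof.
intros hf h; hand h as h1 h2; apply and_i.
- hall q hq; himp hqf.
  hex (imp_e (all_e h1 (up hq)) hqf) as x hx h3; hex h3 as y hy h4.
  hand h4 as h4 h5; pose proof (opair_components hx hy hq h5) as hM.
  apply (ex_i x (and_e1 hM)), (ex_i y (and_e2 hM)), and_i; auto.
  apply opair_down; auto.
- hall x hx; himp hxd.
  hex (imp_e (all_e h2 (up hx)) hxd) as y hy h3; hand h3 as h3 h4.
  pose proof (and_e2 (graph_components (up hx) hy hf h3)) as hyM.
  apply (ex_i y hyM), and_i; [apply graph_down; auto|].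
  hall z hz; himp h5; use (all_e h4 (up hz)); apply graph_up; auto.
Qed.

Lemma inductive_up {p a} : p ⊩ M a -> p ⊩ inductive M a -> p ⊩ inductive N a.
Proof.
intros ha h; hand h as h1 h2; apply and_i.
- hex h1 as o ho h3; hand h3 as h3 h4.
  apply (ex_i o (up ho)), and_i; auto; apply empty_up; auto.
- apply (all_mem_up ha); hall x hx; himp hxa.
  hex (imp_e (all_e h2 hx) hxa) as s hs h3; hand h3 as h3 h4.
  apply (ex_i s (up hs)), and_i; auto; apply succ_up; auto.
Qed.

Lemma inductive_down {p a} : p ⊩ M a -> p ⊩ inductive N a -> p ⊩ inductive M a.
Proof.
intros ha h; hand h as h1 h2; apply and_i.
- hex h1 as o ho h3; hand h3 as h3 h4.
  apply (ex_i o (down ha ho h4)), and_i; auto; apply all_down; auto.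
- hall x hx; himp hxa.
  hex (imp_e (all_e h2 (up hx)) hxa) as s hs h3; hand h3 as h3 h4.
  apply (ex_i s (down ha hs h4)), and_i; auto; apply all_down; auto.
Qed.

Lemma bit_up {p x} : p ⊩ M x -> p ⊩ is_bit M x -> p ⊩ is_bit N x.
Proof.
intros hx h; hor h as h1; [apply or_i1, empty_up; auto|].
hex h1 as o ho h2; hand h2 as h2 h3.
apply or_i2, (ex_i o (up ho)), and_i; [apply empty_up | apply succ_up]; auto.
Qed.

Lemma bit_down {p x} : p ⊩ M x -> p ⊩ is_bit N x -> p ⊩ is_bit M x.
Proof.
intros hx h; hor h as h1; [apply or_i1, all_down; auto|].
hex h1 as o ho h2; hand h2 as h2 h3.
apply or_i2, (ex_i o (down hx ho (succ_intro_r _ h3 ho))), and_i; apply all_down; auto.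
Qed.

End Absoluteness.

(** * Transfer of ω, its subsets and the functions from ω to 2 *)

Section SameOrdinals.

Context {H : completeHeyting} {V : structure H} (M N : cls V)
  (MsubN : valid (subclass M N)) (Mtrans : valid (transitive_in M N))
  (izfM : IZF M) (izfN : IZF N).
Implicit Types (p : H) (b c f m n o q s t w x y z : V).

Let up {p x} := @up _ _ M N MsubN p x.
Let down {p x y} := @down _ _ M N Mtrans p x y.

Lemma ordinal_in_M {p x} : p ⊩ same_ordinals N M -> p ⊩ N x ->
  p ⊩ ordinal N x -> p ⊩ M x.
Proof.
intros h hx ho.
exact (and_e1 (imp_e (and_e1 (proj1 (le_inf _ _ _ _) h x)) (and_i hx ho))).
Qed.

(** As an ordinal of [N], [w] lies in [M]. It is minimal there because inductive sets of [M] remain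
    inductive in [N]. *)
Lemma omega_in_M {p w} : p ⊩ same_ordinals N M -> p ⊩ N w ->
  p ⊩ is_omega N w -> p ⊩ M w ⊓ is_omega M w.
Proof.
intros h hN hw.
pose proof (ordinal_in_M h hN (omega_ordinal N izfN hw hN)) as hM.
apply and_i; auto; apply and_i.
- exact (inductive_down M N MsubN Mtrans hM (and_e1 hw)).
- hall b hb; himp hi; apply (all_down M N MsubN).
  use (and_e2 hw).
  + exact (up hb).
  + exact (inductive_up M N MsubN Mtrans hb hi).
Qed.

(** For minimality in [N], the ω of [N], called [w'], also lies in [M], so [w ⊆ w' ⊆ b] for every
    inductive [b] in [N]. *)
Lemma omega_up {p w} : p ⊩ same_ordinals N M -> p ⊩ M w ->
  p ⊩ is_omega M w -> p ⊩ is_omega N w.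
Proof.
intros h hM hw; apply and_i.
- exact (inductive_up M N MsubN Mtrans hM (and_e1 hw)).
- hex (valid_forced (strong_infinity _ izfN) p) as w' hN' hw'.
  pose proof (omega_in_M h hN' hw') as h1; hand h1 as hM' hw2.
  hall b hb; himp hi; apply (all_mem_up M N Mtrans hM); hall z hz; himp hzw.
  use (all_e (imp_e (all_e (and_e2 hw') hb) hi) (up hz)).
  use (imp_e (all_e (and_e2 hw) hM') (and_e1 hw2)).
Qed.

(* [n ∈ X] iff the code of [n] belongs to the ordinal [b] that codes [X]:
   otherwise that code is included in [ω], or is the code of an element of
   [X], which is then [n]. *)
Lemma subset_omega_in_M {p w X} : p ⊩ same_ordinals N M ->
  p ⊩ has_nonclassical_ordinal M -> p ⊩ N w -> p ⊩ is_omega N w ->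
  p ⊩ N X -> p ⊩ subset N X w -> p ⊩ M X.
Proof.
intros h hord hN hwN hX hXw.
pose proof (omega_in_M h hN hwN) as h1; hand h1 as hM hwM.
hex (beta_exists N izfN hwN hN hX hXw) as b hb hbeta.
pose proof (ordinal_in_M h hb (beta_ordinal N izfN hwN hN hX hXw hb hbeta)) as hbM.
hex (sep M izfM (FEx _ (FAnd _ (FMem _ v0 v2) (fCode v1 v0))) (ext b enil)
  (fun n => ∃[M] c, c ∈ b ⊓ is_code M n c) (fun _ => eq_refl) _ w
  (params_ext M hbM (params_nil M)) hM) as Y hY hm.
refine (cls_eq M _ hY).
apply (ext_eq N izfN (up hY) hX).
- hall z hz; himp hzY; pose proof (down hY hz hzY) as hzM.
  pose proof (imp_e (and_e1 (all_e hm hzM)) hzY) as h1; hand h1 as hzw h1.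
  hex h1 as c hc h2; hand h2 as hcb hcode.
  hor (imp_e (and_e1 (all_e hbeta (up hc))) hcb) as h2.
  (* Here [c] would be a subset of ω, which yields excluded middle for membership in [M]. *)
  + refine (lem_not_nonclassical M izfM _ hord).
    apply (code_subset_omega_lem M izfM hwM hM hzM hzw hc hcode).
    exact (all_down M N MsubN (and_e2 h2)).
  + hex h2 as m hmN h3; hand h3 as hmX hcode2.
    assert (hmw : p ⊩ m ∈ w) by (use hXw).
    refine (mem_eql _ hmX); apply eq_sym_f.
    exact (code_injective M izfM hwM hM hzM hzw (down hM hmN hmw) hmw hc
      hcode (code_down M N MsubN Mtrans hcode2)).
- hall z hz; himp hzX.
  assert (hzw : p ⊩ z ∈ w) by (use hXw).
  pose proof (down hM hz hzw) as hzM.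
  use (and_e2 (all_e hm hzM)); apply and_i; auto.
  (* The code is formed in [N]; as an element of [b] it lies in [M]. *)
  hex (code_exists N izfN hwN hN hz hzw) as c hc hcode.
  assert (hcb : p ⊩ c ∈ b).
  { use (and_e2 (all_e hbeta hc)); apply or_i2, (ex_i z hz), and_i; auto. }
  apply (ex_i c (down hbM hc hcb)), and_i; auto.
  exact (code_down M N MsubN Mtrans hcode).
Qed.

Lemma two_in_M {p w t} : p ⊩ same_ordinals N M ->
  p ⊩ has_nonclassical_ordinal M -> p ⊩ N w -> p ⊩ is_omega N w ->
  p ⊩ N t -> p ⊩ is_two N t -> p ⊩ M t.
Proof.
intros h hord hN hw ht htwo; apply (subset_omega_in_M h hord hN hw ht).
hall x hx; himp hxt.
exact (bit_in_omega N izfN hw hN hx (imp_e (and_e1 (all_e htwo hx)) hxt)).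
Qed.

(** An element of 2 in the sense of [N] is a natural number, so it lies in [M] and is counted by
    [t]. *)
Lemma two_up {p w t} : p ⊩ M w -> p ⊩ is_omega N w ->
  p ⊩ M t -> p ⊩ is_two M t -> p ⊩ is_two N t.
Proof.
intros hM hw ht htwo; hall x hx; apply and_i; himp h.
- pose proof (down ht hx h) as hxM.
  exact (bit_up M N MsubN Mtrans hxM (imp_e (and_e1 (all_e htwo hxM)) h)).
- pose proof (down hM hx (bit_in_omega N izfN hw (up hM) hx h)) as hxM.
  exact (imp_e (and_e2 (all_e htwo hxM)) (bit_down M N MsubN Mtrans hxM h)).
Qed.

Lemma two_down {p t} : p ⊩ M t -> p ⊩ is_two N t -> p ⊩ is_two M t.
Proof.
intros ht htwo; hall x hx; apply and_i; himp h.
- exact (bit_down M N MsubN Mtrans hx (imp_e (and_e1 (all_e htwo (up hx))) h)).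
- exact (imp_e (and_e2 (all_e htwo (up hx))) (bit_up M N MsubN Mtrans hx h)).
Qed.

Lemma cantor_up {p f} : p ⊩ same_ordinals N M ->
  p ⊩ M f -> p ⊩ cantor M f -> p ⊩ cantor N f.
Proof.
intros h hf hc; hex hc as w hw h1; hex h1 as t ht h2.
hand h2 as hwo h2; hand h2 as htwo h2; hand h2 as hfun hval.
pose proof (omega_up h hw hwo) as hwN.
apply (ex_i w (up hw)), (ex_i t (up ht)), and_i; [|apply and_i; [|apply and_i]]; auto.
- exact (two_up hw hwN ht htwo).
- exact (function_on_up M N MsubN Mtrans hf hw hfun).
- hall x hx; hall y hy; himp hg.
  pose proof (graph_components M N Mtrans hx hy hf hg) as h3.
  use (all_e (all_e hval (and_e1 h3)) (and_e2 h3)).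
  exact (graph_down M N MsubN Mtrans hf hg).
Qed.

Lemma cantor_down {p f} : p ⊩ same_ordinals N M ->
  p ⊩ has_nonclassical_ordinal M ->
  p ⊩ M f -> p ⊩ cantor N f -> p ⊩ cantor M f.
Proof.
intros h hord hf hc; hex hc as w hw h1; hex h1 as t ht h2.
hand h2 as hwo h2; hand h2 as htwo h2; hand h2 as hfun hval.
pose proof (omega_in_M h hw hwo) as hwo2; hand hwo2 as hwM hwoM.
pose proof (two_in_M h hord hw hwo ht htwo) as htM.
apply (ex_i w hwM), (ex_i t htM), and_i; [|apply and_i; [|apply and_i]]; auto.
- exact (two_down htM htwo).
- exact (function_on_down M N MsubN Mtrans hf hfun).
- hall x hx; hall y hy; himp hg.
  use (all_e (all_e hval (up hx)) (up hy)).
  exact (graph_up M N MsubN Mtrans hf hx hy hg).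
Qed.

Lemma preimage_in_M {p w f z} : p ⊩ same_ordinals N M ->
  p ⊩ has_nonclassical_ordinal M -> p ⊩ N w -> p ⊩ is_omega N w ->
  p ⊩ N f -> p ⊩ N z ->
  p ⊩ (∃[M] X, ∀[N] n, n ∈ X ⇔ n ∈ w ⊓ graph N f n z).
Proof.
intros h hord hN hw hf hz.
hex (sep N izfN (fGraph v1 v0 v2) (ext f (ext z enil)) (fun n => graph N f n z)
  (fun _ => eq_refl) _ w (params_ext N hf (params_ext N hz (params_nil N))) hN)
  as X hX hm.
refine (ex_i X _ hm); apply (subset_omega_in_M h hord hN hw hX).
hall x hx; himp hxX; exact (and_e1 (imp_e (and_e1 (all_e hm hx)) hxX)).
Qed.

(** The preimages [X0] of 0 and [X1] of 1 are subsets of ω, hence lie in [M]. There a copy [g] of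
    [f] is separated using them, and extensionality in [N] identifies [g] with [f]. *)
Lemma cantor_in_M {p f} : p ⊩ same_ordinals N M ->
  p ⊩ has_nonclassical_ordinal M ->
  p ⊩ N f -> p ⊩ cantor N f -> p ⊩ M f.
Proof.
intros h hord hf hc; hex hc as w hw h1; hex h1 as t ht h2; clear h1.
hand h2 as hwo h2; hand h2 as htwo h2; hand h2 as hfun hval.
hand hfun as hrel htot.
pose proof (omega_in_M h hw hwo) as hwo2; hand hwo2 as hwM hwoM.
hex (omega_zero N hwo) as z0 hz0 h3; hand h3 as he h0w.
hex (omega_succ N hwo hz0 h0w) as z1 hz1 h3; hand h3 as hs h1w.
hex (preimage_in_M h hord hw hwo hf hz0) as X0 hX0 hm0.
hex (preimage_in_M h hord hw hwo hf hz1) as X1 hX1 hm1.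
pose proof (down hwM hz0 h0w) as hz0M; pose proof (down hwM hz1 h1w) as hz1M.
(* Kuratowski pairs of natural numbers lie in the second power set of ω. *)
hex (powerset M izfM hwM) as P hP hPm.
hex (powerset M izfM hP) as Q hQ hQm.
(* Inside the two quantifiers, variables 0 to 6 stand for [y], [x], [q], [z0], [z1], [X0], [X1]. *)
hex (sep M izfM (FEx _ (FEx _ (FAnd _ (fOpair v1 v0 v2)
    (FOr _ (FAnd _ (FEq _ v0 v3) (FMem _ v1 (Fin.FS v4)))
           (FAnd _ (FEq _ v0 v4) (FMem _ v1 (Fin.FS (Fin.FS v4))))))))
  (ext z0 (ext z1 (ext X0 (ext X1 enil))))
  (fun q => ∃[M] x y, is_opair M x y q ⊓
     ((y ≐ z0 ⊓ x ∈ X0) ⊔ (y ≐ z1 ⊓ x ∈ X1))) (fun _ => eq_refl) _ Q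
  (params_ext M hz0M (params_ext M hz1M (params_ext M hX0 (params_ext M hX1
    (params_nil M))))) hQ) as g hg hgm.
refine (cls_eq M _ hg).
apply (ext_eq N izfN (up hg) hf).
- hall q hq; himp hqg; pose proof (down hg hq hqg) as hqM.
  hex (and_e2 (imp_e (and_e1 (all_e hgm hqM)) hqg)) as x hx h1.
  hex h1 as y hy h2; hand h2 as hop h2.
  pose proof (opair_up M N MsubN Mtrans hx hy hqM hop) as hopN.
  assert (hgr : p ⊩ graph N f x y).
  { hor h2 as h3; hand h3 as hyz hxX; apply (graph_eq N (eq_sym_f hyz)).
    - exact (and_e2 (imp_e (and_e1 (all_e hm0 (up hx))) hxX)).
    - exact (and_e2 (imp_e (and_e1 (all_e hm1 (up hx))) hxX)). }
  hex hgr as q' hq' h3; hand h3 as hop' hqf.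
  refine (mem_eql _ hqf).
  exact (opair_unique N izfN eq_refl_f eq_refl_f hq' hq hop' hopN).
- hall q hq; himp hqf.
  hex (imp_e (all_e hrel hq) hqf) as x hx h1; hex h1 as y hy h2; hand h2 as hxw hop.
  assert (hgr : p ⊩ graph N f x y) by (apply (ex_i q hq), and_i; auto).
  assert (hyt : p ⊩ y ∈ t) by (use (all_e (all_e hval hx) hy)).
  pose proof (imp_e (and_e1 (all_e htwo hy)) hyt) as hbit.
  pose proof (down hwM hx hxw) as hxM.
  pose proof (bit_in_omega N izfN hwo hw hy hbit) as hyw.
  pose proof (down hwM hy hyw) as hyM.
  (* The pair is rebuilt in [M] as [q']; uniqueness of pairs in [N] identifies it with [q]. *)
  hex (opair_exists M izfM hxM hyM) as q' hq' hop'.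
  pose proof (opair_up M N MsubN Mtrans hxM hyM hq' hop') as hopN.
  refine (mem_eql (opair_unique N izfN eq_refl_f eq_refl_f (up hq') hq hopN hop) _).
  use (and_e2 (all_e hgm hq')); apply and_i.
  + use (and_e2 (all_e hQm hq')); hall s hs'; himp hsq.
    use (and_e2 (all_e hPm hs')); hall z hz; himp hzs.
    hex hop' as a ha h3; hex h3 as b hb h4.
    hand h4 as hpa h4; hand h4 as hpb hpq.
    hor (imp_e (and_e1 (all_e hpq hs')) hsq) as h5;
      [pose proof (imp_e (and_e1 (all_e hpa hz)) (mem_eqr h5 hzs)) as h6
      |pose proof (imp_e (and_e1 (all_e hpb hz)) (mem_eqr h5 hzs)) as h6];
    hor h6 as h7;
      first [exact (mem_eql (eq_sym_f h7) hxw)|exact (mem_eql (eq_sym_f h7) hyw)].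
  + apply (ex_i x hxM), (ex_i y hyM), and_i; auto.
    hor (bit_cases N izfN hy hz0 hz1 he hs hbit) as h3.
    * apply or_i1, and_i; auto; use (and_e2 (all_e hm0 hx)).
      apply and_i; auto; exact (graph_eq N h3 hgr).
    * apply or_i2, and_i; auto; use (and_e2 (all_e hm1 hx)).
      apply and_i; auto; exact (graph_eq N h3 hgr).
Qed.

End SameOrdinals.

Theorem mainTheorem15 (H : completeHeyting) (V : structure H) (M N : cls V)
  (MsubN : valid (subclass M N))
  (Mtrans : valid (transitive_in M N))
  (izfM : IZF M)
  (izfN : IZF N)
  (wemM : valid (weak_excluded_middle M))
  (ordM : valid (has_nonclassical_ordinal M)) :
  valid (same_ordinals N M ⇒ same_cantor N M).
Proof.
apply imp_i; intros p _ h.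
pose proof (valid_forced ordM p) as hord.
apply le_inf; intros f; apply and_i; himp hf; hand hf as hf hc.
- pose proof (cantor_in_M M N MsubN Mtrans izfM izfN h hord hf hc) as hM.
  apply and_i; auto.
  exact (cantor_down M N MsubN Mtrans izfM izfN h hord hM hc).
- exact (and_i (up M N MsubN hf) (cantor_up M N MsubN Mtrans izfN h hf hc)).
Qed.
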